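(* Let $k\geq 0$ and let $P=\{i_0,i_1,\ldots,i_s\}\subseteq\{0,1,\ldots,k\}$ with $0=i_0<i_1<\cdots<i_s$. Suppose $P$ is none of the following: $\{0\}$; $\{0,l\}$ with $1\leq l\leq k$; $\{0,1,l\}$ with $2\leq l\leq k$; $\{0,1,2,l\}$ with $4\leq l\leq k$; the full set $\{0,1,\ldots,k\}$. Then $P$ is not hereditary, i.e. there exists an orderly currency $A=(1,a_1,\ldots,a_k)$ such that the sub-currency $(a_{i_0},a_{i_1},\ldots,a_{i_s})$ is not orderly.
   Context: A currency is a finite sequence of integers $A=(a_0,a_1,\ldots,a_k)$ with $1=a_0<a_1<\cdots<a_k$. For an integer amount $c>0$, $\mathrm{opt}_A(c)$ is the minimum number of coins (values from $A$, repetitions allowed) summing to $c$, and $\mathrm{grd}_A(c)$ is the number of coins used by the greedy algorithm, which repeatedly takes the largest coin not exceeding the remaining amount. $A$ is orderly if $\mathrm{opt}_A(c)=\mathrm{grd}_A(c)$ for all integers $c>0$. A set $P=\{i_0<\cdots<i_s\}\subseteq\{0,\ldots,k\}$ with $i_0=0$ determines, for each currency $A=(1,a_1,\ldots,a_k)$, the sub-currency $(a_{i_0},\ldots,a_{i_s})$; $P$ is hereditary if for every orderly currency $A$ with $k+1$ coins the sub-currency determined by $P$ is orderly. *)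

(* Defs.v *)
From mathcomp Require Import all_boot.

Set Implicit Arguments.
Unset Strict Implicit.
Unset Printing Implicit Defensive.

(* All coins are at least 1, so currencies and amounts live in nat. *)
Definition currency (A : seq nat) : bool := (head 0 A == 1) && sorted ltn A.

(* c is the total value of n coins from A; the i-th coin of the payment is
   given by its index in A. *)
Definition payable (A : seq nat) (c n : nat) : bool :=
  [exists t : n.-tuple 'I_(size A), \sum_(i <- t) nth 0 A i == c].

(* The least n such that c is payable with n coins. The search may stop at c,
   since c coins of value 1 always suffice; see optP. *)
Definition opt (A : seq nat) (c : nat) : nat :=
  find (payable A c) (iota 0 c.+1).

Definition largest_coin (A : seq nat) (c : nat) : nat :=
  \max_(a <- A | a <= c) a.

(* Each greedy step decreases the amount, so fuel c is enough to pay c;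
   see grdE. *)
Fixpoint greedy (fuel : nat) (A : seq nat) (c : nat) : nat :=
  if fuel is n.+1 then
    if c == 0 then 0 else (greedy n A (c - largest_coin A c)).+1
  else 0.

Definition grd (A : seq nat) (c : nat) : nat := greedy c A c.

Definition orderly (A : seq nat) : Prop :=
  forall c : nat, 0 < c -> opt A c = grd A c.

(* enum P lists P in increasing order. *)
Definition subcurrency (k : nat) (A : k.+1.-tuple nat) (P : {set 'I_k.+1}) :
  seq nat := [seq tnth A i | i <- enum P].

Definition hereditary (k : nat) (P : {set 'I_k.+1}) : Prop :=
  forall A : k.+1.-tuple nat,
    currency A -> orderly A -> orderly (subcurrency A P).

Lemma optP (A : seq nat) (c : nat) : currency A ->
  payable A c (opt A c) /\ (forall n, payable A c n -> opt A c <= n).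
Proof.
case: A => [|a A] // /andP[/= /eqP a1 _]; subst a.
have pc : payable (1 :: A) c c.
  apply/existsP; exists [tuple of nseq c ord0].
  by rewrite big_nseq /= iter_addn_0 mul1n.
have hasp : has (payable (1 :: A) c) (iota 0 c.+1).
  by apply/hasP; exists c => //; rewrite mem_iota /= add0n ltnS.
have lt : opt (1 :: A) c < c.+1 by move: hasp; rewrite has_find size_iota.
split.
  by move: (nth_find 0 hasp); rewrite -/(opt _ c) nth_iota.
move=> n pn; rewrite leqNgt; apply/negP => ltn.
have := before_find 0 ltn.
by rewrite nth_iota ?(ltn_trans ltn lt) // add0n pn.
Qed.

Lemma largest_coin_gt0 (A : seq nat) (c : nat) :
  currency A -> 0 < c -> 0 < largest_coin A c.
Proof.
case: A => [|a A] // /andP[/= /eqP -> _] c0.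
by rewrite /largest_coin big_cons c0 leq_max.
Qed.

Lemma grd0 (A : seq nat) : grd A 0 = 0.
Proof. by []. Qed.

Lemma grdE (A : seq nat) (c : nat) : currency A -> 0 < c ->
  grd A c = (grd A (c - largest_coin A c)).+1.
Proof.
move=> cA.
have fuelE : forall n m c, c <= n -> c <= m -> greedy n A c = greedy m A c.
  elim=> [|n IH] [|m] c' //=; try by case: c'.
  move=> len lem; case: eqP => // /eqP; rewrite -lt0n => c0.
  have l0 := largest_coin_gt0 cA c0.
  have lt : c' - largest_coin A c' < c' by rewrite ltn_subrL l0 c0.
  by congr _.+1; apply: IH; rewrite -ltnS (leq_trans lt).
case: c => // c _; rewrite {1}/grd /=; congr _.+1; apply: fuelE => //.
have l0 := @largest_coin_gt0 A c.+1 cA isT.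
by rewrite -ltnS ltn_subrL l0.
Qed.

Lemma subcurrency_currency (k : nat) (A : k.+1.-tuple nat) (P : {set 'I_k.+1}) :
  ord0 \in P -> currency A -> currency (subcurrency A P).
Proof.
move=> P0 /andP[A0 sA].
have lttr : transitive (fun i j : 'I_k.+1 => i < j).
  by move=> y x z; apply: ltn_trans.
have se : sorted (fun i j : 'I_k.+1 => i < j) (enum P).
  rewrite {1}/enum_mem -enumT /=; apply: sorted_filter => //.
  by have := iota_ltn_sorted 0 k.+1; rewrite -val_enum_ord sorted_map.
apply/andP; split.
  have : ord0 \in enum P by rewrite mem_enum.
  rewrite /subcurrency; case: (enum P) se => // x s /= se.
  rewrite inE => /orP[/eqP <-|os].
    by rewrite (tnth_nth 0) nth0.
  by have /allP/(_ _ os) := order_path_min lttr se.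
rewrite /subcurrency sorted_map; apply: sub_sorted se => i j ij.
by rewrite /= !(tnth_nth 0) (sorted_ltn_nth ltn_trans) ?inE ?size_tuple.
Qed.

(* Main.v *)
Require Import Defs.
From mathcomp Require Import all_boot.
From mathcomp Require Import zify.

(** A bad pattern of positions stays bad when the currency gets longer: append
    a huge multiple of the top coin. So it suffices to treat the minimal bad
    patterns, namely [{0, l, k}], [{0, 1, l, k}] and [{0, 1, 2, l, k}], each with
    a gap before [l], and [{0, ..., n}] in a currency with [n + 2] coins, [n >= 3].
    For the first three, start from [(1, b)], [(1, a, 2a - 1)] or
    [(1, 2, a, 2a - 1)], whose top coin [b] is expensive once it is dropped;
    double up to index [k - 1] and end with [2h - b], [h] being the previous coin.
    The one-point theorem shows that the whole currency is orderly. For the last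
    pattern take [(1, ..., m, 2m, 2m + 1, 4m)], a generalization of
    [(1, 2, 4, 5, 8)]. *)

Set Implicit Arguments.
Unset Strict Implicit.
Unset Printing Implicit Defensive.

(** Orderliness with payments as lists of coin values, which can be concatenated and shortened
    freely; [good_orderly] gives back [orderly]. *)
Definition good (A : seq nat) : Prop :=
  forall s : seq nat, {subset s <= A} -> grd A (sumn s) <= size s.

Definition select (p : pred nat) (A : seq nat) : seq nat :=
  [seq nth 0 A i | i <- iota 0 (size A) & p i].

(** Positions are a predicate on [nat], so one pattern applies to currencies of every length. The
    list [s] is the payment that beats greedy in the sub-currency. *)
Definition bad (p : pred nat) (n : nat) : Prop :=
  exists A s : seq nat,
    [/\ size A = n, currency A, good A, {subset s <= select p A}
      & size s < grd (select p A) (sumn s)].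

(** * Currencies and the greedy algorithm *)

Lemma currency_rcons (A : seq nat) (y : nat) :
  currency A -> last 0 A < y -> currency (rcons A y).
Proof.
case: A => [|a A] //= /andP[/= a1 sA] ly.
by rewrite /currency /= a1 rcons_path sA.
Qed.

Lemma currency_mem1 (A : seq nat) : currency A -> 1 \in A.
Proof. by case: A => [|a A] // /andP[/= /eqP -> _]; rewrite inE eqxx. Qed.

Lemma currency_last_mem (A : seq nat) : currency A -> last 0 A \in A.
Proof. by case: A => [|a A] // _; rewrite /= mem_last. Qed.

Lemma currency_le_last (A : seq nat) (a : nat) :
  currency A -> a \in A -> a <= last 0 A.
Proof.
move=> /andP[_]; case/lastP: A => // A y.
rewrite (sorted_pairwise ltn_trans) pairwise_rcons last_rcons => /andP[/allP lty _].
by rewrite mem_rcons inE => /orP[/eqP -> //|/lty /ltnW].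
Qed.

Lemma largest_coin_mem (A : seq nat) (c : nat) :
  currency A -> 0 < c -> largest_coin A c \in A /\ largest_coin A c <= c.
Proof.
move=> cA c0; have := largest_coin_gt0 cA c0; rewrite /largest_coin {cA}.
elim: A => [|a A IH]; first by rewrite big_nil.
rewrite big_cons; case: ifP => ac; last first.
  by move=> /IH[aA lc]; rewrite inE aA orbT.
case: (leqP a) => [_ /IH[aA lc]|_ _]; first by rewrite inE aA orbT.
by rewrite inE eqxx.
Qed.

Lemma leq_largest_coin (A : seq nat) (c a : nat) :
  a \in A -> a <= c -> a <= largest_coin A c.
Proof. by move=> aA ac; rewrite /largest_coin (big_rem a) //= ac leq_maxl. Qed.

Lemma largest_coinP (A : seq nat) (c a : nat) :
  a \in A -> a <= c -> (forall b, b \in A -> b <= c -> b <= a) ->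
  largest_coin A c = a.
Proof.
move=> aA ac ub; apply/eqP; rewrite eqn_leq; apply/andP; split.
  by apply/bigmax_leqP_seq.
exact: leq_largest_coin.
Qed.

Lemma greedy_ext (A B : seq nat) (c : nat) :
  (forall b, b <= c -> (b \in A) = (b \in B)) -> grd A c = grd B c.
Proof.
move=> AB; rewrite /grd.
suff H n d : d <= c -> greedy n A d = greedy n B d by exact: H.
elim: n d => //= n IH d dc; case: eqP => // _; congr _.+1.
have -> : largest_coin A d = largest_coin B d.
  apply/eqP; rewrite eqn_leq; apply/andP; split; apply/bigmax_leqP_seq => b bm bd;
    apply: leq_largest_coin => //; move: bm; rewrite AB //; exact: leq_trans dc.
by rewrite IH // (leq_trans (leq_subr _ _)).
Qed.

Lemma grd_rcons_lt (A : seq nat) (y c : nat) :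
  c < y -> grd (rcons A y) c = grd A c.
Proof.
by move=> cy; apply: greedy_ext => b bc; rewrite mem_rcons inE; case: eqP => // ?; lia.
Qed.

Lemma grd_coin (A : seq nat) (a c : nat) : currency A ->
  a \in A -> 0 < a <= c -> (forall b, b \in A -> b <= c -> b <= a) ->
  grd A c = (grd A (c - a)).+1.
Proof.
by move=> cA aA /andP[a0 ac] ub; rewrite grdE ?(largest_coinP aA) // (leq_trans a0).
Qed.

Lemma currency_last_gt0 (A : seq nat) : currency A -> 0 < last 0 A.
Proof. by move=> cA; exact: (currency_le_last cA (currency_mem1 cA)). Qed.

Lemma grd_last (A : seq nat) (c : nat) : currency A -> last 0 A <= c ->
  grd A c = (grd A (c - last 0 A)).+1.
Proof.
move=> cA lc; apply: grd_coin; rewrite ?currency_last_mem ?currency_last_gt0 //.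
by move=> b bA _; exact: currency_le_last.
Qed.

Lemma grd_mulD (A : seq nat) (q c : nat) : currency A ->
  grd A (q * last 0 A + c) = q + grd A c.
Proof.
move=> cA; elim: q => [|q IH]; first by rewrite mul0n.
by rewrite grd_last ?mulSn -?addnA ?leq_addr // addKn IH.
Qed.

Lemma grd_mem (A : seq nat) (a : nat) : currency A -> 0 < a -> a \in A -> grd A a = 1.
Proof. by move=> cA a0 aA; rewrite (grd_coin cA aA) ?a0 ?leqnn // subnn. Qed.

Lemma leq_grd_last (A : seq nat) (c : nat) : currency A -> c <= grd A c * last 0 A.
Proof.
move=> cA; elim/ltn_ind: c => c IH; case: (posnP c) => [->//|c0].
rewrite grdE // mulSn.
have [lA lc] := largest_coin_mem cA c0.
have l0 := largest_coin_gt0 cA c0.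
have := currency_le_last cA lA.
have := IH (c - largest_coin A c) _; lia.
Qed.

Lemma grd_repr (A : seq nat) (c : nat) : currency A ->
  exists s : seq nat, [/\ {subset s <= A}, sumn s = c & size s = grd A c].
Proof.
move=> cA; elim/ltn_ind: c => c IH; case: (posnP c) => [->|c0]; first by exists [::].
have [lA lc] := largest_coin_mem cA c0.
have l0 := largest_coin_gt0 cA c0.
have [|s [sA ss zs]] := IH (c - largest_coin A c); first lia.
exists (largest_coin A c :: s); split; last by rewrite grdE //= zs.
  by move=> x; rewrite inE => /orP[/eqP ->|/sA].
by rewrite /= ss subnKC.
Qed.

(** * From lists of coins to orderliness, and the one-point theorem *)

Lemma payable_size (A s : seq nat) : {subset s <= A} -> payable A (sumn s) (size s).
Proof.
case: A => [|a A] sA.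
  case: s sA => [|x s] sA; last by have := sA x (mem_head _ _).
  by apply/existsP; exists [tuple]; rewrite big_nil.
apply/existsP; exists (map_tuple (fun x => inord (index x (a :: A))) (in_tuple s)).
rewrite big_map sumnE !big_seq; apply/eqP/eq_bigr => x /sA xA.
by rewrite inordK ?nth_index // -[(size A).+1]/(size (a :: A)) index_mem.
Qed.

Lemma payable_repr (A : seq nat) (c n : nat) : payable A c n ->
  exists s : seq nat, [/\ {subset s <= A}, sumn s = c & size s = n].
Proof.
move=> /existsP[t /eqP tc]; exists [seq nth 0 A i | i : 'I_(size A) <- (t : seq _)]; split.
- by move=> x /mapP[i _ ->]; rewrite mem_nth.
- by rewrite sumnE big_map.
- by rewrite size_map size_tuple.
Qed.


Lemma good_orderly (A : seq nat) : currency A -> good A -> orderly A.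
Proof.
move=> cA gA c _; have [pay min] := optP c cA; apply/eqP; rewrite eqn_leq.
have [s [sA sc sz]] := grd_repr c cA; have [t [tA tc tz]] := payable_repr pay.
rewrite min -?sz -?{1}sc ?payable_size //.
by have := gA t tA; rewrite tc tz sz sc.
Qed.

Lemma not_orderly (A s : seq nat) : currency A -> {subset s <= A} ->
  size s < grd A (sumn s) -> ~ orderly A.
Proof.
move=> cA sA lt oA; have [_ min] := optP (sumn s) cA.
case: (posnP (sumn s)) lt => [->//|s0]; rewrite -oA // ltnNge => /negP; apply.
exact/min/payable_size.
Qed.

(* The one-point theorem: [m = ceil (y / h)] for the previous top coin [h], and
   the greedy payment of [m h] by [y] followed by coins of [A] uses at most [m] coins. *)
Lemma good_rcons (A : seq nat) (y m : nat) : currency A -> good A ->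
  last 0 A < y -> m * last 0 A < y + last 0 A -> y <= m * last 0 A ->
  grd A (m * last 0 A - y) < m -> good (rcons A y).
Proof.
move=> cA gA; set h := last 0 A => hy lo hi gm s.
have cB := currency_rcons cA hy.
(* Write [c = (m - 1) h + u]. Greedy payments of [u] and of [m h - y] together pay [h + (c - y)],
   the latter with at most [m - 1] coins; cancelling one [h] gives the bound. *)
have top c : y <= c -> (grd A (c - y)).+1 <= grd A c.
  move=> yc; have [u cE] : exists u, c = m.-1 * h + u by exists (c - m.-1 * h); nia.
  have [s1 [s1A s1u s1z]] := grd_repr u cA.
  have [s2 [s2A s2u s2z]] := grd_repr (m * h - y) cA.
  have /gA : {subset s1 ++ s2 <= A} by move=> x; rewrite mem_cat => /orP[/s1A|/s2A].
  rewrite sumn_cat size_cat s1u s2u s1z s2z.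
  have -> : u + (m * h - y) = 1 * h + (c - y) by nia.
  have -> : grd A c = m.-1 + grd A u by rewrite cE grd_mulD.
  by rewrite grd_mulD //; lia.
have [n] := ubnP (sumn s); elim: n s => // n IH s; rewrite ltnS => sn sB.
case: (ltnP (sumn s) y) => [lt|le].
  rewrite grd_rcons_lt //; apply: gA => x xs; have := sB _ xs.
  rewrite mem_rcons inE => /orP[/eqP xy|//].
  by have := perm_sumn (perm_to_rem xs); rewrite /= => e; lia.
rewrite grd_last ?last_rcons //.
have y0 : 0 < y by lia.
case: (boolP (y \in s)) => [ys|nys].
  have e := perm_sumn (perm_to_rem ys); rewrite /= in e.
  have -> : sumn s - y = sumn (rem y s) by lia.
  rewrite (perm_size (perm_to_rem ys)) /= ltnS; apply: IH; first lia.
  by move=> x /mem_rem /sB.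
have sA : {subset s <= A}.
  move=> x xs; have := sB _ xs; rewrite mem_rcons inE => /orP[/eqP xy|//].
  by rewrite -xy xs in nys.
(* Here [s] avoids [y]. By [top], the greedy payment [t] of the remainder in [A] is shorter than
   that of [sumn s], hence than [s], and induction applies to [t]. *)
have [t [tA tc tz]] := grd_repr (sumn s - y) cA.
apply: leq_trans (gA _ sA); apply: leq_trans (top _ le).
rewrite ltnS -tz -tc; apply: IH; first lia.
by move=> x /tA xA; rewrite mem_rcons inE xA orbT.
Qed.

Lemma good_rcons_mul (A : seq nat) (m : nat) : currency A -> good A -> 1 < m ->
  good (rcons A (m * last 0 A)).
Proof.
move=> cA gA m1; have l0 := currency_last_gt0 cA.
by apply: (@good_rcons _ _ m) => //; rewrite ?subnn ?grd0; nia.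
Qed.

(** Take [m = 2] in the one-point theorem: the deficit is [b], a single coin. *)
Lemma good_rcons_double_sub (A : seq nat) (b : nat) : currency A -> good A ->
  b \in A -> 0 < b < last 0 A -> good (rcons A (2 * last 0 A - b)).
Proof.
move=> cA gA bA bl; apply: (@good_rcons _ _ 2) => //; try lia.
have -> : 2 * last 0 A - (2 * last 0 A - b) = b by lia.
by rewrite grd_mem //; lia.
Qed.

(** * Selected positions and longer currencies *)

Lemma select_rcons (p : pred nat) (A : seq nat) (y : nat) :
  select p (rcons A y) = if p (size A) then rcons (select p A) y else select p A.
Proof.
rewrite /select size_rcons -addn1 iotaD filter_cat map_cat /=.
have -> : [seq nth 0 (rcons A y) i | i <- iota 0 (size A) & p i]
        = [seq nth 0 A i | i <- iota 0 (size A) & p i].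
  apply/eq_in_map => i; rewrite mem_filter mem_iota => /and3P[_ _ iA].
  by rewrite nth_rcons iA.
by case: ifP => _; rewrite ?cats0 //= nth_rcons ltnn eqxx cats1.
Qed.

(** The new coin exceeds [sumn s], so greedy never uses it on that amount, whether or not its
    position is selected. *)
Lemma badS (p : pred nat) (n : nat) : bad p n -> bad p n.+1.
Proof.
move=> [A [s [<- cA gA sS lt]]]; have l0 := currency_last_gt0 cA.
exists (rcons A ((sumn s + 2) * last 0 A)), s; split.
- by rewrite size_rcons.
- by apply: currency_rcons => //; nia.
- by apply: good_rcons_mul => //; lia.
- by move=> x /sS xS; rewrite select_rcons; case: ifP; rewrite // mem_rcons inE xS orbT.
- by rewrite select_rcons; case: ifP; rewrite // grd_rcons_lt //; nia.
Qed.

Lemma bad_leq (p : pred nat) (m n : nat) : m <= n -> bad p m -> bad p n.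
Proof.
move=> /subnK <- pm; elim: (n - m) => [//|d IH].
exact: badS.
Qed.

(** Fills a run of unselected positions by repeated doubling of the top coin. *)
Lemma double_ext (p : pred nat) (A : seq nat) (n : nat) : currency A -> good A ->
  (forall i, size A <= i < size A + n -> ~~ p i) ->
  exists B : seq nat, [/\ currency B, good B, size B = size A + n,
    {subset A <= B} & last 0 B = 2 ^ n * last 0 A /\ select p B = select p A].
Proof.
move=> cA gA; elim: n => [|n IH] np; first by exists A; split; rewrite ?addn0 ?mul1n.
have [|B [cB gB zB AB [lB sB]]] := IH; first by move=> i ?; apply: np; lia.
have l0 := currency_last_gt0 cB.
exists (rcons B (2 * last 0 B)); split.
- by apply: currency_rcons => //; lia.
- exact: good_rcons_mul.
- by rewrite size_rcons zB addnS.
- by move=> x /AB xB; rewrite mem_rcons inE xB orbT.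
- rewrite last_rcons lB mulnA expnS; split=> //.
  by rewrite select_rcons (negbTE (np _ _)) // zB; lia.
Qed.

(* With [b] the top coin of [A], append [2b, 4b, ..., x, 2x, ..., h, 2h - b], where
   [x] has index [l]. The amount [2h = 2^(k-l) x] needs only [2^(k-l)] coins [x],
   but its greedy payment is [2h - b] followed by the greedy payment of [b]. *)
Lemma bad_tail (p : pred nat) (A : seq nat) (l k : nat) :
  currency A -> good A -> currency (select p A) -> last 0 (select p A) < last 0 A ->
  size A <= l < k -> (forall i, size A <= i < k -> p i = (i == l)) -> p k ->
  2 ^ (k - l) <= grd (select p A) (last 0 A) -> bad p k.+1.
Proof.
set S := select p A; set b := last 0 A => cA gA cS Sb /andP[Al lk] pi pk big.
have b0 : 0 < b := currency_last_gt0 cA.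
have [|B [cB gB zB AB [lB sB]]] := @double_ext p A (l - size A) cA gA.
  by move=> i ?; rewrite pi; lia.
have e0 : 0 < 2 ^ (l - size A) by rewrite expn_gt0.
set x := 2 * last 0 B; have xb : 2 * b <= x by rewrite /x lB -/b; nia.
have cC : currency (rcons B x) by apply: currency_rcons => //; rewrite /x lB -/b; nia.
have gC : good (rcons B x) by apply: good_rcons_mul.
have zC : size (rcons B x) = l.+1 by rewrite size_rcons zB; lia.
have sC : select p (rcons B x) = rcons S x.
  by rewrite select_rcons sB zB subnKC // pi ?eqxx //; lia.
have [|D [cD gD zD CD [lD sD]]] := @double_ext p (rcons B x) (k - l.+1) cC gC.
  by move=> i; rewrite zC => ?; rewrite pi; lia.
rewrite sC in sD; rewrite last_rcons in lD.
set h := last 0 D in lD *.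
have hE : 2 * h = 2 ^ (k - l) * x.
  by rewrite lD mulnA -expnS subnSK.
have e1 : 0 < 2 ^ (k - l.+1) by rewrite expn_gt0.
have hx : x <= h by rewrite lD leq_pmull.
(* The final coin [2h - b] keeps the currency good because its deficit [b] is a coin. *)
have bD : b \in D.
  by apply: CD; rewrite mem_rcons inE AB ?orbT // currency_last_mem.
have kD : size D = k by rewrite zD zC; lia.
have sE : select p (rcons D (2 * h - b)) = rcons (rcons S x) (2 * h - b).
  by rewrite select_rcons kD pk sD.
exists (rcons D (2 * h - b)), (nseq (2 ^ (k - l)) x); rewrite sE; split.
- by rewrite size_rcons kD.
- by apply: currency_rcons => //; rewrite -/h; lia.
- by apply: good_rcons_double_sub => //; rewrite -/h; lia.
- move=> z; rewrite mem_nseq => /andP[_ /eqP ->].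
  by rewrite mem_rcons inE mem_rcons mem_head orbT.
(* The remainder [b] is below both [x] and [2h - b], so only coins of [S] pay it. *)
rewrite size_nseq sumn_nseq [x * _]mulnC -hE grd_last ?last_rcons; last lia.
  by rewrite ltnS subKn ?grd_rcons_lt //; lia.
by apply: currency_rcons; [apply: currency_rcons => //|rewrite last_rcons]; lia.
Qed.

(** * The minimal bad patterns *)

Lemma good1 : good [:: 1].
Proof.
move=> s s1; have c1 : currency [:: 1] by [].
have -> : sumn s = size s * last 0 [:: 1] + 0.
  elim: s s1 => //= x s IH s1; rewrite IH => [|y ys].
    by have := s1 x (mem_head _ _); rewrite inE => /eqP ->; lia.
  by apply: s1; rewrite inE ys orbT.
by rewrite grd_mulD // grd0 addn0.
Qed.

Lemma good2 (a : nat) : 1 < a -> good [:: 1; a].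
Proof. by move=> a1; have := @good_rcons_mul [:: 1] a isT good1 a1; rewrite muln1. Qed.

Lemma bad_0_l_k (p : pred nat) (l k : nat) : p 0 -> 2 <= l < k ->
  (forall i, 0 < i < k -> p i = (i == l)) -> p k -> bad p k.+1.
Proof.
(* With only the coin 1 selected, [b] costs [b] coins, more than [2 ^ (k - l)]. *)
move=> p0 lk pi pk; set b := (2 ^ (k - l)).+1.
have b1 : 1 < b by rewrite ltnS expn_gt0.
have pF : p 1 = false by rewrite pi; lia.
have sE : select p [:: 1; b] = [:: 1] by rewrite /select /= p0 pF.
apply: (@bad_tail p [:: 1; b] l) => //; rewrite ?sE //=.
- by rewrite /currency /= b1.
- exact: good2.
- by move=> i ?; apply: pi; lia.
- by have := @leq_grd_last [:: 1] b isT; rewrite muln1 /b /=; lia.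
Qed.

Lemma bad_0_1_l_k (p : pred nat) (l k : nat) : p 0 -> p 1 -> 3 <= l < k ->
  (forall i, 1 < i < k -> p i = (i == l)) -> p k -> bad p k.+1.
Proof.
(* Greedy on [(1, a)] pays [2a - 1] with [a] and then [a - 1] ones: exactly [2 ^ (k - l)] coins. *)
move=> p0 p1 lk pi pk; set a := (2 ^ (k - l)).
have a1 : 1 < a by rewrite /a (leq_pexp2l (_ : 0 < 2) (_ : 1 <= k - l)) //; lia.
have pF : p 2 = false by rewrite pi; lia.
have sE : select p [:: 1; a; 2 * a - 1] = [:: 1; a].
  by rewrite /select /= p0 p1 pF.
have c2 : currency [:: 1; a] by rewrite /currency /= a1.
have g := @good_rcons_double_sub _ 1 c2 (good2 a1) (mem_head _ _).
apply: (@bad_tail p [:: 1; a; 2 * a - 1] l) => //; rewrite ?sE //=; try lia.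
- by rewrite /currency /= a1 andbT; lia.
- exact: g.
- by move=> i ?; apply: pi; lia.
rewrite -/a grd_last //=; last lia.
rewrite (@grd_rcons_lt [:: 1] a); last lia.
by have := @leq_grd_last [:: 1] (2 * a - 1 - a) isT; rewrite muln1 /=; lia.
Qed.

Lemma bad_0_1_2_l_k (p : pred nat) (l k : nat) : p 0 -> p 1 -> p 2 -> 4 <= l < k ->
  (forall i, 2 < i < k -> p i = (i == l)) -> p k -> bad p k.+1.
Proof.
(* The extra factor 2 compensates for the coin 2: after [a], the remainder [a - 1] still costs at
   least [a / 2 = 2 ^ (k - l)] coins. It also makes [a] a multiple of 2. *)
move=> p0 p1 p2 lk pi pk; set a := 2 ^ (k - l) * 2.
have a2 : 2 < a.
  by rewrite /a -expnSr (@leq_trans (2 ^ 2)) // leq_pexp2l //; lia.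
have pF : p 3 = false by rewrite pi; lia.
have sE : select p [:: 1; 2; a; 2 * a - 1] = [:: 1; 2; a].
  by rewrite /select /= p0 p1 p2 pF.
have c3 : currency [:: 1; 2; a] by rewrite /currency /= a2.
have g3 : good [:: 1; 2; a].
  apply: (@good_rcons_mul [:: 1; 2]) => //; first exact: good2.
  by rewrite /a in a2; lia.
have g := @good_rcons_double_sub _ 1 c3 g3 (mem_head _ _).
apply: (@bad_tail p [:: 1; 2; a; 2 * a - 1] l) => //; rewrite ?sE //=; try lia.
- by rewrite /currency /= a2 andbT; lia.
- by apply: g => /=; lia.
- by move=> i ?; apply: pi; lia.
rewrite grd_last //=; last lia.
rewrite (@grd_rcons_lt [:: 1; 2] a); last lia.
by have := @leq_grd_last [:: 1; 2] (2 * a - 1 - a) isT; rewrite /= {1 2}/a; lia.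
Qed.

(* The currency is [1, 2, ..., m, 2m, 2m + 1, 4m]; without its top coin it pays [4m]
   greedily with [2m + 1] first, although two coins [2m] suffice. *)
Lemma bad_init (p : pred nat) (m : nat) : 1 < m ->
  (forall i, i < m + 2 -> p i) -> ~~ p (m + 2) -> bad p (m + 3).
Proof.
move=> m1 pi np; pose U := iota 1 m.
have lU : last 0 U = m by rewrite -nth_last size_iota nth_iota; lia.
have mU a : (a \in U) = (0 < a <= m) by rewrite mem_iota; lia.
have cU : currency U.
  by rewrite /currency iota_ltn_sorted andbT /U -(prednK (ltnW m1)).
set C := rcons (rcons U (2 * m)) (2 * m).+1.
have c1 : currency (rcons U (2 * m)) by apply: currency_rcons; rewrite // lU; lia.
have cC : currency C by apply: currency_rcons; rewrite // last_rcons.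
have cD : currency (rcons C (4 * m)) by apply: currency_rcons; rewrite // last_rcons; lia.
have zC : size C = m + 2 by rewrite !size_rcons size_iota addn2.
have sC : select p C = C.
  rewrite /select zC (eq_in_filter (a2 := predT)) ?filter_predT.
    by rewrite -zC -/(mkseq _ _) mkseq_nth.
  by move=> i; rewrite mem_iota => /pi.
have sD : select p (rcons C (4 * m)) = C by rewrite select_rcons zC (negbTE np).
(* Values for [r < 4m]: 0 at 0, 1 up to [m], 2 below [2m], 1 at [2m] and [2m + 1], 2 up to [3m + 1],
   then 3. Since [C] is not orderly, the one-point theorem does not apply; instead [q + g r] is
   compared with greedy and with arbitrary payments. *)
pose g r := (0 < r) + (m < r) + ((2 * m).+1 < r) + ((3 * m).+1 < r) - (2 * m <= r).
have grdU r : r < 2 * m -> grd U r <= g r.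
  move=> r2; have [->//|r0] := posnP r; have [rm|rm] := leqP r m.
    by rewrite grd_mem ?mU /g; lia.
  rewrite grd_last // lU; last lia.
  by rewrite grd_mem ?mU /g; lia.
have grdD r : r < 4 * m -> grd (rcons C (4 * m)) r <= g r.
  move=> r4; rewrite grd_rcons_lt //; case: (ltnP (2 * m) r) => r2; last first.
    rewrite grd_rcons_lt //; case: (ltngtP r (2 * m)) r2 => // [lt|->] _.
      by rewrite grd_rcons_lt // grdU.
    by rewrite grd_mem ?mem_rcons ?mem_head /g //; lia.
  rewrite grd_last ?last_rcons // !grd_rcons_lt; try lia.
  have := @grdU (r - (2 * m).+1) _; rewrite /g; lia.
exists (rcons C (4 * m)), (nseq 2 (2 * m)); rewrite sD; split => //.
- by rewrite size_rcons zC addn3 addn2.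
- move=> s sA.
  suff [q [r [qr r4 le]]] : exists q r, [/\ sumn s = q * (4 * m) + r, r < 4 * m
      & q + g r <= size s].
    have := grd_mulD q r cD; rewrite last_rcons qr => ->; apply: leq_trans le.
    by rewrite leq_add2l grdD.
  (* One more coin raises [q + g r] by at most 1, with or without a carry into [q]. *)
  elim: s sA => [|a s IH] sA; first by exists 0, 0; split => //; lia.
  have [|q [r [qr r4 le]]] := IH; first by move=> x xs; apply: sA; rewrite inE xs orbT.
  have := sA a (mem_head _ _); rewrite !(mem_rcons, inE) mU => aD.
  have [lt|ge] := ltnP (r + a) (4 * m).
    exists q, (r + a); split=> //=; first lia.
    apply: (@leq_trans (q + g r).+1) => //; rewrite -addnS leq_add2l.
    by move: aD; rewrite /g; lia.
  exists q.+1, (r + a - 4 * m); split=> /=; [lia|lia|].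
  apply: (@leq_trans (q + g r).+1) => //; rewrite addSn ltnS leq_add2l.
  by move: aD; rewrite /g; lia.
- move=> x; rewrite mem_nseq => /andP[_ /eqP ->].
  by rewrite mem_rcons inE mem_rcons mem_head orbT.
rewrite size_nseq /= addn0 grd_last ?last_rcons //; last lia.
rewrite !grd_rcons_lt; try lia.
(* After [2m + 1] there remains [2m - 1 > m], which needs at least two more coins. *)
by have := @leq_grd_last U (2 * m + 2 * m - (2 * m).+1) cU; rewrite lU; nia.
Qed.

(** * Reduction of an arbitrary set to a minimal pattern *)

(** Agreement with [s] up to [n] but not up to [k] forces an element beyond [n]; the least one is
    [j]. Iterating this lists [P] in increasing order. *)
Lemma next_index (p : pred nat) (k n : nat) (s : seq nat) :
  (forall i, i <= n -> p i = (i \in s)) -> {in s, forall i, i <= n} ->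
  ~ (forall i, i <= k -> p i = (i \in s)) ->
  exists j, [/\ n < j <= k, p j & forall i, n < i < j -> p i = false].
Proof.
move=> ps sn neq; case: (boolP (has p (iota n.+1 (k - n)))) => [/hasP[j0 j0k pj0]|np].
  have ex : exists i, (n < i) && p i.
    by exists j0; rewrite pj0 andbT; move: j0k; rewrite mem_iota; lia.
  case: (ex_minnP ex) => j /andP[nj pj] min; exists j; split=> //.
    have := min j0; rewrite pj0 andbT; move: j0k; rewrite mem_iota; lia.
  by move=> i ij; apply: contraTF isT => pi; have := min i; rewrite pi andbT; lia.
case: neq => i ik; case: (leqP i n) => [/ps //|ni].
move/hasPn/(_ i): np; rewrite mem_iota => npi; rewrite (negbTE (npi _)); last lia.
by apply/esym; apply: contraTF ni => /sn; rewrite leqNgt.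
Qed.

Theorem theorem7p5 (k : nat) (P : {set 'I_k.+1})
  (P0 : ord0 \in P)
  (hP1 : P <> [set ord0])
  (hP2 : forall l : nat, 1 <= l <= k ->
     P <> [set i : 'I_k.+1 | (i : nat) \in [:: 0; l]])
  (hP3 : forall l : nat, 2 <= l <= k ->
     P <> [set i : 'I_k.+1 | (i : nat) \in [:: 0; 1; l]])
  (hP4 : forall l : nat, 4 <= l <= k ->
     P <> [set i : 'I_k.+1 | (i : nat) \in [:: 0; 1; 2; l]])
  (hPT : P <> [set: 'I_k.+1]) :
  ~ hereditary P /\
  exists A : k.+1.-tuple nat,
    [/\ currency A, orderly A & ~ orderly (subcurrency A P)].

Proof.
pose p (i : nat) := i \in [seq val o | o in P].
have pP (o : 'I_k.+1) : p o = (o \in P) by rewrite /p mem_map ?mem_enum //; exact: val_inj.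
have subE (A : k.+1.-tuple nat) : subcurrency A P = select p A.
  rewrite /subcurrency /select size_tuple -val_enum_ord filter_map -map_comp /=.
  have -> : enum P = [seq o <- enum 'I_k.+1 | p (val o)].
    by rewrite (eq_filter pP) enumT.
  by apply: eq_map => o /=; rewrite (tnth_nth 0).
have pset (s : seq nat) : P <> [set i : 'I_k.+1 | (i : nat) \in s] ->
    ~ (forall i, i <= k -> p i = (i \in s)).
  by move=> neq ps; apply: neq; apply/setP => o; rewrite inE -pP ps // -ltnS.
have p0 : p 0 by rewrite (pP ord0).
suff [A [s [zA cA gA sA lt]]] : bad p k.+1.
  have e : size A == k.+1 by apply/eqP.
  have cS : currency (select p A).
    by rewrite -(subE (Tuple e)); apply: subcurrency_currency.
  suff H : exists B : k.+1.-tuple nat,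
      [/\ currency B, orderly B & ~ orderly (subcurrency B P)].
    by split=> //; case: H => B [cB oB nB] her; apply: nB; apply: her.
  exists (Tuple e); split=> //=; first exact: good_orderly.
  by rewrite subE; apply: not_orderly sA lt.
have upd n (s : seq nat) j : (forall i, i <= n -> p i = (i \in s)) ->
    {in s, forall i, i <= n} -> n < j <= k -> p j -> (forall i, n < i < j -> p i = false) ->
    (forall i, i <= j -> p i = (i \in rcons s j)) /\ {in rcons s j, forall i, i <= j}.
  move=> ps sn nj pj gap; split=> i.
    rewrite mem_rcons inE => ij; have [->//|nij] := eqVneq i j.
    have [/ps //|ni] := leqP i n; rewrite gap; last lia.
    by apply/esym; apply: contraTF ni => /sn; rewrite leqNgt.
  rewrite mem_rcons inE => /orP[/eqP ->//|/sn i_n]; lia.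
have h0 i : i <= 0 -> p i = (i \in [:: 0]) by case: i.
have b0 : {in [:: 0], forall i, i <= 0} by move=> i; rewrite inE => /eqP ->.
have [|l1 [lk1 pl1 g1]] := @next_index p k 0 [:: 0] h0 b0.
  by apply: pset => PE; apply: hP1; rewrite PE; apply/setP => o; rewrite !inE.
have [h1 b1] := upd _ _ _ h0 b0 lk1 pl1 g1.
have [|l2 [lk2 pl2 g2]] := @next_index p k l1 _ h1 b1; first exact/pset/hP2.
have [h2 b2] := upd _ _ _ h1 b1 lk2 pl2 g2.
(* At the first gap in [P], the next two elements give a minimal pattern, and [bad_leq] lengthens
   the currency to [k + 1] coins. *)
have [l1E|l1n] := eqVneq l1 1; last first.
  apply: (@bad_leq p l2.+1); first lia.
  apply: (@bad_0_l_k p l1) => //; first lia.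
  by move=> i ?; case: (ltngtP i l1) => il; [apply: g1|apply: g2|rewrite il]; lia.
subst l1.
have [|l3 [lk3 pl3 g3]] := @next_index p k l2 _ h2 b2; first exact/pset/hP3.
have [h3 b3] := upd _ _ _ h2 b2 lk3 pl3 g3.
have [l2E|l2n] := eqVneq l2 2; last first.
  apply: (@bad_leq p l3.+1); first lia.
  apply: (@bad_0_1_l_k p l2) => //; first lia.
  by move=> i ?; case: (ltngtP i l2) => il; [apply: g2|apply: g3|rewrite il]; lia.
subst l2.
have [l3E|l3n] := eqVneq l3 3; last first.
  have [|l4 [lk4 pl4 g4]] := @next_index p k l3 _ h3 b3; first by apply/pset/hP4; lia.
  apply: (@bad_leq p l4.+1); first lia.
  apply: (@bad_0_1_2_l_k p l3) => //; first lia.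
  by move=> i ?; case: (ltngtP i l3) => il; [apply: g3|apply: g4|rewrite il]; lia.
subst l3.
have ex : exists i : nat, ~~ p i && (i <= k).
  have /set0Pn[o] : ~: P != set0.
    by apply: contra_not_neq hPT => PC; rewrite -[P]setCK PC setC0.
  by rewrite inE -pP => npo; exists (val o); rewrite npo -ltnS ltn_ord.
(* Now [P] starts with 0, 1, 2, 3, and [n] is its least missing position; [bad_init] is used with
   [m = n - 2]. *)
case: (ex_minnP ex) => n /andP[npn nk] min.
have n4 : 3 < n.
  by rewrite ltnNge; apply: contra npn => n3; rewrite h3 //; case: n n3 {nk min} => [|[|[|[|]]]].
have nE : n = n - 2 + 2 by lia.
apply: (@bad_leq p (n - 2 + 3)); first lia.
apply: bad_init; rewrite -?nE //; first lia.
move=> i lt; apply: contraTT isT => npi; have := min i; rewrite npi /=; lia.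
Qed.
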